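(* The set $E$ of admissible kneading sequences has positive $(\tfrac12,\tfrac12)$-product measure as a subset of $\{0,1\}^{\mathbb{N}^*}$.
   Context: Let $\mathbb{N}^*=\{1,2,3,\dots\}$. Let $\Sigma^1$ be the set of all sequences $\nu=\nu_1\nu_2\nu_3\dots\in\{0,1\}^{\mathbb{N}^*}$ with $\nu_1=1$; by convention kneading sequences start with $1$, and the elements of $\Sigma^1$ are called kneading sequences. The $(\tfrac12,\tfrac12)$-product measure on $\{0,1\}^{\mathbb{N}^*}$ is the Bernoulli measure giving each of the symbols $0,1$ weight $\tfrac12$ in each coordinate, independently. For $\nu\in\Sigma^1$ define $\rho=\rho_\nu:\mathbb{N}^*\to\mathbb{N}^*\cup\{\infty\}$ by $\rho_\nu(n)=\inf\{s>n:\nu_s\neq\nu_{s-n}\}$ (with $\inf\emptyset=\infty$). For $s\in\mathbb{N}^*$ the $\rho$-orbit of $s$ is $\mathrm{orb}_\rho(s)=\{\rho^{\circ i}(s)\}_{i\ge 0}$ (it stops once the value $\infty$ is reached). The internal address of $\nu$ is the $\rho$-orbit of $1$, written $1=S_0\to S_1\to S_2\to\dots$ with $S_{k+1}=\rho(S_k)$; if $\rho^{\circ (k+1)}(1)=\infty$, the internal address is finite: $1\to\rho(1)\to\dots\to\rho^{\circ k}(1)$. Admissibility condition: $\nu$ fails the admissibility condition for period $m\in\mathbb{N}^*$ if the following three conditions hold: (1) the internal address of $\nu$ does not contain $m$; (2) if $s<m$ divides $m$, then $\rho(s)\le m$; (3) $\rho(m)<\infty$, and if $r\in\{1,\dots,m\}$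 is congruent to $\rho(m)$ modulo $m$, then $\mathrm{orb}_\rho(r)$ contains $m$. The kneading sequence $\nu$ is called admissible if there is no $m\ge1$ for which it fails the admissibility condition. $E\subset\Sigma^1$ denotes the set of all admissible $\nu\in\Sigma^1$. *)

(* Defs.v *)
From HB Require Import structures.
From mathcomp Require Import all_boot all_order all_algebra.
From mathcomp Require Import all_classical all_reals all_analysis.
From mathcomp Require Import lra.

Set Implicit Arguments.
Unset Strict Implicit.
Unset Printing Implicit Defensive.

Import Order.TTheory GRing.Theory Num.Theory.
Local Open Scope classical_set_scope.
Local Open Scope ring_scope.

(** * The measurable space {0,1}^{N*} *)

(* The sequence [nu_1 nu_2 nu_3 ...] is stored with indices shifted by one:
   [x i] is the symbol [nu_(i+1)], see [symb].  The sigma-algebra is the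
   product one, i.e., the one generated by the coordinates. *)
Definition coord_sets : set (set (nat -> bool)) :=
  \bigcup_i preimage_set_system setT (fun x : nat -> bool => x i) measurable.

Definition binseq := g_sigma_algebraType coord_sets.

(* Only meaningful for [0 < n]. *)
Definition symb (nu : binseq) (n : nat) : bool := (nu : nat -> bool) n.-1.

(* [P] is the product of the measures [mu i], [i : nat]. *)
Definition is_product_measure (R : realType) (mu : nat -> probability bool R)
    (P : probability binseq R) : Prop :=
  forall (n : nat) (A : nat -> set bool),
    P [set x : binseq | forall i, (i < n)%N -> A i (x i)] =
    (\prod_(i < n) mu i (A i))%E.

(* The (1/2, 1/2)-product measure; [exists_half_product_measure] below shows
   that there is one. *)
Definition is_half_product_measure (R : realType) (P : probability binseq R) :=
  is_product_measure (fun=> bernoulli_prob (2^-1 : R)) P.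

(** * Kneading sequences and admissibility *)

(* [None] stands for infinity. *)
Definition rho (nu : binseq) (n : nat) : option nat :=
  if pselect (exists s, ((n < s) && (symb nu s != symb nu (s - n)))%N)
  is left ex then Some (ex_minn ex) else None.

Definition orb (nu : binseq) (s : nat) : set nat :=
  [set m | exists i, iter i (obind (rho nu)) (Some s) = Some m].

Definition internal_address (nu : binseq) : set nat := orb nu 1.

Definition fails_admissibility (nu : binseq) (m : nat) : Prop :=
  [/\ ~ internal_address nu m,
      forall s, (0 < s < m)%N -> (s %| m)%N ->
        exists2 t, rho nu s = Some t & (t <= m)%N
    & exists2 t, rho nu m = Some t &
        forall r, (0 < r <= m)%N -> r = t %[mod m] -> orb nu r m].

Definition kneading_sequences : set binseq := [set nu | symb nu 1 = true].

Definition admissible (nu : binseq) : Prop :=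
  forall m, (0 < m)%N -> ~ fails_admissibility nu m.

Definition admissible_kneading_sequences : set binseq :=
  [set nu | kneading_sequences nu /\ admissible nu].

(** * Existence of the (1/2, 1/2)-product measure *)

Section existence.
Variable R : realType.

Let digits (x : R) : binseq := fun i => odd (Num.truncn (x * 2 ^+ i.+1)).

Let cyl_index (w : nat -> bool) (n : nat) : nat :=
  iteri n (fun i k => k.*2 + w i)%N 0%N.

Let truncn_double (y : R) : 0 <= y ->
  Num.truncn (y * 2) = ((Num.truncn y).*2 + odd (Num.truncn (y * 2)))%N.
Proof.
move=> y0; set t := Num.truncn (y * 2).
suff -> : Num.truncn y = t./2 by rewrite addnC odd_double_half.
have /andP[t1 t2] : (t%:R : R) <= y * 2 < t.+1%:R by rewrite truncn_itv// mulr_ge0.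
move: t1 t2; rewrite -{1 2}(odd_double_half t) -addn1 !natrD -muln2 natrM => t1 t2.
apply: truncn_def; rewrite -addn1 natrD.
have b1 : ((odd t)%:R : R) <= 1 by case: (odd t).
have b0 : 0 <= ((odd t)%:R : R) by case: (odd t).
by apply/andP; split; lra.
Qed.

Let digits_cyl (w : nat -> bool) (n : nat) (x : R) : 0 <= x < 1 ->
  (forall i, (i < n)%N -> digits x i = w i) <->
  Num.truncn (x * 2 ^+ n) = cyl_index w n.
Proof.
move=> /andP[x0 x1]; elim: n => [|n IH].
  rewrite expr0 mulr1 /cyl_index/=; split=> // _.
  by apply: truncn_def; rewrite x0.
have E : Num.truncn (x * 2 ^+ n.+1) =
    ((Num.truncn (x * 2 ^+ n)).*2 + digits x n)%N.
  by rewrite /digits exprSr mulrA {1}truncn_double// mulr_ge0// exprn_ge0.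
rewrite E /cyl_index/= -/(cyl_index w n); split=> [H|H].
  by rewrite (IH.1 (fun i h => H i (ltnW h))) H.
have dw : digits x n = w n.
  by move: (congr1 odd H); rewrite !oddD !odd_double/= !oddb.
move: H; rewrite dw => /addIn /double_inj /IH H i.
by rewrite ltnS leq_eqVlt => /predU1P[->//|/H].
Qed.


Let dyadic_itv (n k : nat) :
  [set x : R | 0 <= x < 1 /\ Num.truncn (x * 2 ^+ n) = k] =
  [set x : R | 0 <= x < 1] `&`
    `[(k%:R / 2 ^+ n : R), (k.+1%:R / 2 ^+ n : R)[%classic.
Proof.
have p0 : 0 < 2 ^+ n :> R by rewrite exprn_gt0.
apply/seteqP; split=> x /= [/andP[x0 x1]].
  move=> <-; split; first by rewrite x0.
  by rewrite in_itv/= ler_pdivrMr// ltr_pdivlMr// truncn_itv// mulr_ge0// exprn_ge0.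
rewrite in_itv/= ler_pdivrMr// ltr_pdivlMr// => H.
by rewrite x0 x1; split=> //; exact: truncn_def.
Qed.

Let measurable_truncn (n k : nat) :
  measurable [set x : measurableTypeR R | (0 : R) <= x < 1 /\ Num.truncn ((x : R) * 2 ^+ n) = k].
Proof.
rewrite dyadic_itv; apply: measurableI; last exact: measurable_itv.
rewrite (_ : [set _ | _] = `[(0 : R), 1[%classic); first exact: measurable_itv.
by apply/seteqP; split=> x /=; rewrite in_itv.
Qed.

Let digits01 (x : R) : binseq :=
  if 0 <= x < 1 then digits x else (fun=> false).

Let measurable_digits01 : measurable_fun setT (digits01 : measurableTypeR R -> binseq).
Proof.
apply: (@measurability _ _ (measurableTypeR R) binseq setT digits01 coord_sets) => // _ [_ [i _ [A mA <-]] <-].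
rewrite !setTI.
have m01 : measurable [set x : measurableTypeR R | (0 : R) <= x < 1].
  rewrite (_ : [set _ | _] = `[(0 : R), 1[%classic); first exact: measurable_itv.
  by apply/seteqP; split=> x /=; rewrite in_itv.
rewrite (_ : _ @^-1` _ = (~` [set x : R | 0 <= x < 1] `&` [set _ | A false])
   `|` \bigcup_(k in [set k | A (odd k)])
     [set x : R | 0 <= x < 1 /\ Num.truncn (x * 2 ^+ i.+1) = k]).
  apply: measurableU; last by apply: bigcup_measurable => k _.
  apply: measurableI; first exact: measurableC.
  have [Af|Af] := pselect (A false).
    by rewrite (_ : [set _ | _] = setT)//; apply/seteqP; split.
  by rewrite (_ : [set _ | _] = set0)//; apply/seteqP; split.
apply/seteqP; split=> x /=; rewrite /digits01 /=.
  case: ifPn => x01 H; last by left; split=> //; apply/negP.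
  by right; exists (Num.truncn (x * 2 ^+ i.+1)).
by case=> [[/negP/negbTE -> //]|[k /= Ak [-> kE]]]; rewrite /digits kE.
Qed.

Let cyl_index_lt (w : nat -> bool) (n : nat) : (cyl_index w n < 2 ^ n)%N.
Proof.
elim: n => // n IH; rewrite /cyl_index/= -/(cyl_index w n) expnS mul2n.
rewrite -(@leq_double _.+1) in IH; apply: leq_trans IH.
by rewrite doubleS ltnS -addn1 leq_add2l leq_b1.
Qed.

Let m01 : measurable (`[(0 : R), 1[%classic : set (measurableTypeR R)).
Proof. exact: measurable_itv. Qed.

Let cyl_measure (w : nat -> bool) (n : nat) :
  lebesgue_measure ([set x : R | forall i, (i < n)%N -> digits01 x i = w i]
    `&` `[0, 1[) = (2^-1 ^+ n)%:E.
Proof.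
set k := cyl_index w n.
have p0 : 0 < 2 ^+ n :> R by rewrite exprn_gt0.
rewrite (_ : _ `&` _ = `[(k%:R / 2 ^+ n : R), (k.+1%:R / 2 ^+ n : R)[%classic).
  rewrite lebesgue_measure_itv/= lte_fin ltr_pM2r ?invr_gt0// ltr_nat ltnSn.
  by rewrite -EFinB -mulrBl -natrB// subSnn mul1r exprVn.
transitivity [set x : R | 0 <= x < 1 /\ Num.truncn (x * 2 ^+ n) = k].
  apply/seteqP; split=> x /=; rewrite in_itv/= /digits01.
    by case=> + x01; rewrite x01 => /(digits_cyl w n x01).
  by case=> x01 xk; rewrite x01; split=> //; apply/(digits_cyl w n x01).
rewrite dyadic_itv; apply: setIidr => x /=; rewrite in_itv/= => /andP[kx xk].
apply/andP; split; first by apply: le_trans kx; rewrite divr_ge0// ltW.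
apply: (lt_le_trans xk); rewrite ler_pdivrMr// mul1r -natrX ler_nat.
exact: cyl_index_lt.
Qed.

Let half01 : 0 <= (2^-1 : R) <= 1.
Proof. by apply/andP; split; lra. Qed.

Let bernoulli_half1 (b : bool) : bernoulli_prob (2^-1 : R) [set b] = (2^-1)%:E.
Proof.
rewrite /bernoulli_prob half01 fsbig_set1 /bernoulli_pmf; case: b => //.
by congr EFin; lra.
Qed.

Let measurable_box (n : nat) (A : nat -> set bool) :
  measurable [set x : binseq | forall i, (i < n)%N -> A i (x i)].
Proof.
rewrite (_ : [set _ | _] =
    \bigcap_(i in `I_n) ((fun x : binseq => (x : nat -> bool) i) @^-1` A i)).
  apply: bigcap_measurableType => i _; apply: sub_sigma_algebra.
  by exists i => //; exists (A i) => //; rewrite setTI.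
by apply/seteqP; split.
Qed.

Let cyl_is_product (P : probability binseq R) :
  (forall (w : nat -> bool) n,
    P [set x : binseq | forall i, (i < n)%N -> x i = w i] = (2^-1 ^+ n)%:E) ->
  is_half_product_measure P.
Proof.
move=> Pw n.
suff H j : (j <= n)%N -> forall A : nat -> set bool,
    (forall i, (j <= i < n)%N -> exists b, A i = [set b]) ->
    P [set x : binseq | forall i, (i < n)%N -> A i (x i)] =
    (\prod_(i < n) bernoulli_prob (2^-1 : R) (A i))%E.
  by move=> A; apply: (H n) => // i; case: ltngtP.
elim: j => [_ A HA|j IH jn A HA].
  pose w i := `[< A i true >].
  have Aw i : (i < n)%N -> A i = [set w i].
    move=> /HA[b]; rewrite /w => ->.
    by case: b; [rewrite asboolT|rewrite asboolF].
  rewrite (_ : [set _ | _] =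
      [set x : binseq | forall i, (i < n)%N -> x i = w i]); last first.
    by apply/seteqP; split=> x /= H i i_n; move: (H i i_n); rewrite Aw.
  rewrite Pw (eq_bigr (fun=> (2^-1 : R)%:E)).
    by rewrite prodEFin prodr_const card_ord.
  by move=> i _; rewrite Aw// bernoulli_half1.
pose A_ B i := if i == j then B else A i.
have AE : A = A_ (A j).
  by apply/funext => i; rewrite /A_; case: eqP => // ->.
have prodA B : (\prod_(i < n) bernoulli_prob (2^-1 : R) (A_ B i) =
    bernoulli_prob (2^-1 : R) B *
    \prod_(i < n | i != Ordinal jn) bernoulli_prob (2^-1 : R) (A i))%E.
  rewrite (bigD1 (Ordinal jn))//= {1}/A_ eqxx; congr (_ * _)%E.
  by apply: eq_bigr => i; rewrite /A_ -val_eqE/= => /negbTE ->.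
have H1 b : P [set x : binseq | forall i, (i < n)%N -> A_ [set b] i (x i)] =
    (\prod_(i < n) bernoulli_prob (2^-1 : R) (A_ [set b] i))%E.
  apply: (IH (ltnW jn)) => i /andP[ji i_n]; rewrite /A_.
  case: eqVneq => [_|ij]; first by exists b.
  by apply: HA; rewrite i_n andbT ltn_neqAle eq_sym ij.
have := @subsetT _ (A j); rewrite setT_bool => AjT.
rewrite AE; have [E|E|E|E] := subset_set2 AjT.
- rewrite E prodA measure0 mul0e (_ : [set _ | _] = set0) ?measure0//.
  by apply/seteqP; split=> // x /(_ j jn); rewrite /A_ eqxx.
- by rewrite E.
- by rewrite E.
rewrite E -setT_bool.
rewrite (_ : [set _ | _] =
    [set x : binseq | forall i, (i < n)%N -> A_ [set true] i (x i)] `|`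
    [set x : binseq | forall i, (i < n)%N -> A_ [set false] i (x i)]).
  rewrite measureU; [|exact: measurable_box..|].
    transitivity (\prod_(i < n) bernoulli_prob (2^-1 : R) (A_ [set true] i) +
        \prod_(i < n) bernoulli_prob (2^-1 : R) (A_ [set false] i))%E.
      by rewrite -!H1.
    rewrite !prodA -ge0_muleDl ?measure_ge0// !bernoulli_half1.
    rewrite probability_setT -EFinD; congr (_%:E * _)%E; lra.
  apply/seteqP; split=> // x /= [/(_ j jn) + /(_ j jn)].
  by rewrite /A_ eqxx /= => -> .
apply/seteqP; split=> x /= H.
  case xj: (x j); [left|right] => i i_n; move: (H i i_n);
    by rewrite /A_; case: eqVneq => [->|].
by case: H => H i i_n; move: (H i i_n); rewrite /A_; case: eqVneq => [->|].
Qed.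

Lemma exists_half_product_measure :
  exists P : probability binseq R, is_half_product_measure P.
Proof.
pose X : {mfun measurableTypeR R >-> binseq} :=
  HB.pack (digits01 : measurableTypeR R -> binseq)
    (isMeasurableFun.Build _ _ _ _ _ measurable_digits01).
pose m : {measure set (measurableTypeR R) -> \bar R} := mrestr (@lebesgue_measure R) m01.
have mT : m setT = 1%E.
  rewrite /m/= /mrestr setTI.
  by rewrite lebesgue_measure_itv/= lte_fin ltr01 sube0.
pose U : probability (measurableTypeR R) R := mnormalize m point.
exists (distribution U X : probability binseq R).
apply: cyl_is_product => w n.
rewrite /distribution /pushforward /U /= /mnormalize -/(m setT) mT.
rewrite onee_eq0/= invr1 mule1.
exact: cyl_measure.
Qed.

End existence.

(* Main.v *)
Require Import Defs.
From HB Require Import structures.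
From mathcomp Require Import all_boot all_order all_algebra.
From mathcomp Require Import all_classical all_reals all_analysis.
From mathcomp Require Import lra zify.

(** Fix the initial word 11000.  Among the sequences starting with it, those
    that fail admissibility for some period have relative measure at most
    25/32, so that a positive proportion is admissible.

    Read [nu] bit by bit, and at time [t] remember, for each starting point
    [s], the last element [visit nu s t] of the [rho]-orbit of [s] that is at
    most [t].  The new bit [nu_(t+1)] is compared with [nu_(t+1-p)], where
    [p = visit nu s t]: if they agree nothing happens, otherwise the orbit
    jumps to [t+1] ([visitS], [orb_visit]).  So two orbits that are compared
    with the same bit merge at once if the new bit is the opposite one.
    Since [nu] starts with 11, whatever the two orbits are doing, there is a
    choice of the next three bits that forces them to merge
    ([merge_within_3]); a choice of three bits has probability 1/8, so the
    probability that the orbits of [k] and of 1 are still apart decays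
    exponentially in time, and the expected number of times at which they are
    apart is at most 24 ([sum_unmerged]).

    Now suppose that [nu] fails for [m], and let [rho m = m + k].  If [k <= m],
    then [k] is the residue of [rho m], so that [m] is in the orbit of [k] but
    not in the internal address, which is the orbit of 1: the two orbits are
    apart at time [m].  The prefix 11000
    makes the orbits of 1, ..., 5 agree from time 5 on and excludes failures
    for [m <= 5], hence [k > 5].  The event [rho m = m + k] prescribes the [k]
    bits after time [m], so it costs a factor [2^-k] independently of the
    merging.  If [k > m], the [m] bits after time [m] copy the first [m] ones,
    which has probability [2^-m] ([fails_shape], [fails_cause]).  Altogether
    the relative measure of the failures is at most
    [\sum_(k > 5) 2^-k * (24 + 1) = 25 / 32]. *)

Import Order.TTheory GRing.Theory Num.Theory.
Local Open Scope classical_set_scope.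
Local Open Scope ring_scope.

(** * Events determined by finitely many bits *)

Definition determined_by {T : Type} (n : nat) (f : binseq -> T) : Prop :=
  forall x y : binseq, (forall i, (i < n)%N -> x i = y i) -> f x = f y.

Lemma determined_byW {T : Type} {n m : nat} {f : binseq -> T} :
  (n <= m)%N -> determined_by n f -> determined_by m f.
Proof. by move=> nm fn x y xy; apply: fn => i /leq_trans/(_ nm); exact: xy. Qed.

Definition cyl (n : nat) (w : binseq) : set binseq :=
  [set x | forall i, (i < n)%N -> x i = w i].

Lemma determined_cyl n w : determined_by n (cyl n w).
Proof.
move=> x y xy; apply/propext; split=> H i i_n; first by rewrite -xy// H.
by rewrite xy// H.
Qed.

(** A choice function [g] prescribes each new bit in terms of the previous ones;
    both the matching of [nu] with a shifted copy of itself and the strategy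
    that merges two orbits are of this form. *)
Lemma determined_bits n d (A : set binseq) (g : nat -> binseq -> bool) :
  determined_by n A -> (forall i, (n <= i)%N -> determined_by i (g i)) ->
  determined_by (n + d)
    (A `&` [set x | forall i, (n <= i < n + d)%N -> x i = g i x]).
Proof.
move=> An gn x y xy; have Axy : A x = A y by apply: An => i i_n; apply: xy; lia.
have gxy i : (n <= i < n + d)%N -> (x i = g i x) = (y i = g i y).
  move=> Hi; rewrite xy; last by lia.
  by rewrite (gn i _ x y)// => [|j ji]; [lia|apply: xy; lia].
rewrite /setI/= Axy; congr and.
by apply/propext; split => H i Hi; move: (H i Hi); rewrite gxy.
Qed.

Definition upd (w : binseq) (n : nat) (b : bool) : binseq :=
  fun i => if i == n then b else w i.

Lemma cylS (n : nat) (w : binseq) (b : bool) :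
  cyl n.+1 (upd w n b) = cyl n w `&` [set x | x n = b].
Proof.
apply/seteqP; split=> x /=.
  move=> xw; split; last by rewrite xw// /upd eqxx.
  by move=> i i_n; rewrite xw 1?ltnW// /upd ltn_eqF.
by move=> [xw xn] i; rewrite /upd ltnS; case: ltngtP => [/xw//||->].
Qed.

(** Splitting the whole space along one coordinate after the other reduces a
    claim on all sequences to cylinders of length [n], on which an event
    determined by [n] bits is everything or nothing. *)
Lemma cylinder_ind (Q : set binseq -> Prop) (n : nat) :
  (forall w, Q (cyl n w)) ->
  (forall (D : set binseq) i, Q (D `&` [set x | x i = true]) ->
     Q (D `&` [set x | x i = false]) -> Q D) ->
  Q setT.
Proof.
move=> base step.
suff H d : (d <= n)%N -> forall w, Q (cyl (n - d) w).
  have -> : [set: binseq] = cyl (n - n) (fun=> false) :> set binseq.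
    by rewrite subnn; apply/seteqP; split.
  exact: H.
elim: d => [_ w|d IH dn w]; first by rewrite subn0; exact: base.
have E : (n - d = (n - d.+1).+1)%N by lia.
by apply: (step _ (n - d.+1)%N); rewrite -cylS -E; apply: IH; exact: ltnW.
Qed.

Lemma measurable_coord (i : nat) (b : bool) : measurable [set x : binseq | x i = b].
Proof.
apply: sub_sigma_algebra; exists i => //; exists [set b] => //.
by rewrite setTI.
Qed.

Lemma measurable_cyl (n : nat) (w : binseq) : measurable (cyl n w).
Proof.
rewrite (_ : cyl n w = \bigcap_(i in `I_n) [set x : binseq | x i = w i]).
  by apply: bigcap_measurableType => i _; exact: measurable_coord.
by apply/seteqP; split.
Qed.

Lemma setI_coordU (D : set binseq) (i : nat) :
  D = (D `&` [set x | x i = true]) `|` (D `&` [set x | x i = false]).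
Proof.
by rewrite -setIUr; apply/esym/setIidl => x _ /=; case: (x i); [left|right].
Qed.

Lemma measurable_determined (n : nat) (A : set binseq) :
  determined_by n A -> measurable A.
Proof.
move=> An; rewrite -[A]setTI.
apply: (cylinder_ind (fun D => measurable (D `&` A)) n) => [w|D i m1 m2].
  have [Aw|Aw] := pselect (A w).
    by rewrite setIidl; [exact: measurable_cyl|move=> x /An ->].
  by rewrite (_ : _ `&` _ = set0)//; apply/seteqP; split=> // x [/An ->].
by rewrite (setI_coordU D i) setIUl; exact: measurableU.
Qed.

(** * Independence of the next bits from the past *)

Definition prob {R : realType} (P : probability binseq R) (A : set binseq) : R :=
  fine (P A).

Section prob_lemmas.
Context {R : realType} (P : probability binseq R).
Local Notation pr := (prob P).

Lemma pr_ge0 A : 0 <= pr A.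
Proof. by rewrite /prob fine_ge0. Qed.

Lemma probE A : measurable A -> P A = (pr A)%:E.
Proof. by move=> mA; rewrite /prob fineK// fin_num_measure. Qed.

Lemma pr_le A B : measurable A -> measurable B -> A `<=` B -> pr A <= pr B.
Proof.
by move=> mA mB AB; rewrite -lee_fin -!probE//; apply: le_measure => //; rewrite inE.
Qed.

Lemma pr_disjointU A B : measurable A -> measurable B -> A `&` B = set0 ->
  pr (A `|` B) = pr A + pr B.
Proof.
move=> mA mB AB; apply: EFin_inj; rewrite EFinD -!probE//; last exact: measurableU.
exact: measureU.
Qed.

(** Countable subadditivity with the sum of the series replaced by a bound on
    its partial sums, so that all further estimates are about real numbers. *)
Lemma pr_bigcup_le (F : nat -> set binseq) (r : R) :
  (forall i, measurable (F i)) -> (forall n, \sum_(i < n) pr (F i) <= r) ->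
  pr (\bigcup_i F i) <= r.
Proof.
move=> mF Fr; rewrite -lee_fin -probE; last exact: bigcup_measurable.
apply: (@le_trans _ _ (\sum_(0 <= i <oo) P (F i))%E).
  by apply: measure_sigma_subadditive => //; exact: bigcup_measurable.
apply: lime_le; first by apply: is_cvg_nneseries => *; exact: measure_ge0.
apply: nearW => n; rewrite big_mkord (eq_bigr (fun i : 'I_n => (pr (F i))%:E)).
  by rewrite sumEFin lee_fin; exact: Fr.
by move=> i _; exact: probE.
Qed.
End prob_lemmas.

Section fair_coin.
Context {R : realType} (P : probability binseq R).
Context (hP : is_half_product_measure P).

Local Notation pr := (prob P).

Lemma pr_cyl n w : pr (cyl n w) = 2^-1 ^+ n.
Proof.
rewrite /prob (hP n (fun i => [set w i])) (eq_bigr (fun=> (2^-1 : R)%:E)).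
  by rewrite prodEFin prodr_const card_ord.
move=> i _; have half01 : 0 <= (2^-1 : R) <= 1 by apply/andP; split; lra.
rewrite /= /bernoulli_prob half01 fsbig_set1 /bernoulli_pmf; case: (w i) => //.
by congr EFin; lra.
Qed.

Lemma pr_split A i : measurable A ->
  pr A = pr (A `&` [set x | x i = true]) + pr (A `&` [set x | x i = false]).
Proof.
move=> mA; rewrite {1}(setI_coordU A i) pr_disjointU//;
  try by apply: measurableI => //; exact: measurable_coord.
by apply/seteqP; split=> // x [[_ /= ->]] [].
Qed.

Lemma pr_fair_bit n (A : set binseq) (g : binseq -> bool) :
  determined_by n A -> determined_by n g ->
  pr (A `&` [set x | x n = g x]) = 2^-1 * pr A.
Proof.
move=> An gn; set G := [set x : binseq | x n = g x].
have mA := measurable_determined _ _ An.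
have mG : measurable G.
  apply: (measurable_determined n.+1) => x y xy; rewrite /G /=.
  by rewrite xy// (gn x y)// => i /ltnW; exact: xy.
pose Q D := measurable D -> pr (D `&` (A `&` G)) = 2^-1 * pr (D `&` A).
suff : Q setT by move/(_ measurableT); rewrite !setTI.
apply: (cylinder_ind Q n) => [w _|D i Q1 Q2 mD].
  have [Aw|Aw] := pselect (A w); last first.
    have cA : cyl n w `&` A = set0 by apply/seteqP; split=> // x [/An ->].
    by rewrite setIA cA set0I /prob measure0 mulr0.
  have cA : cyl n w `&` A = cyl n w by apply/setIidl => x /An ->.
  rewrite setIA cA.
  have -> : cyl n w `&` G = cyl n.+1 (upd w n (g w)).
    rewrite cylS; apply/seteqP; split=> x [] /= xw; rewrite /G /= (gn _ _ xw) => ->;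
    by split.
  by rewrite !pr_cyl exprS.
rewrite (pr_split (D `&` _) i); last by do 2 apply: measurableI => //.
rewrite (pr_split (D `&` A) i); last exact: measurableI.
rewrite !(setIAC D (A `&` G)) !(setIAC D A) Q1 ?Q2 ?mulrDr//;
  by apply: measurableI => //; exact: measurable_coord.
Qed.

(** Each of the [d] next bits is a fair coin given the past, whatever rule
    chooses the value that it is required to take. *)
Lemma pr_fair_bits n d (A : set binseq) (g : nat -> binseq -> bool) :
  determined_by n A -> (forall i, (n <= i)%N -> determined_by i (g i)) ->
  pr (A `&` [set x | forall i, (n <= i < n + d)%N -> x i = g i x]) = 2^-1 ^+ d * pr A.
Proof.
move=> An gn; elim: d => [|d IH].
  rewrite mul1r setIidl// => x _ i /=; lia.
rewrite exprS -mulrA -IH -(pr_fair_bit (n + d) _ (g (n + d)%N)).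
- congr pr; rewrite -setIA; congr (_ `&` _); apply/seteqP; split=> x /=.
    move=> H; split; last by apply: H; lia.
    by move=> i Hi; apply: H; lia.
  move=> [H1 H2] i; rewrite addnS ltnS => /andP[ni]; case: ltngtP => // [id _|-> _//].
  by apply: H1; rewrite ni.
- exact: determined_bits.
- exact: gn (leq_addr _ _).
Qed.
End fair_coin.

(** * Following an orbit in time *)

Lemma rhoP (x : binseq) (n t : nat) : rho x n = Some t <->
  [/\ (n < t)%N, symb x t != symb x (t - n) &
      forall u, (n < u < t)%N -> symb x u = symb x (u - n)].
Proof.
rewrite /rho; case: pselect => [ex|nex]; last first.
  by split=> // -[nt xt _]; case: nex; exists t; rewrite nt.
case: ex_minnP => s /andP[ns xs] smin; split=> [[<-]|[nt xt xu]].
  split=> // u /andP[nu us]; apply/eqP/negPn/negP => xu.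
  by have := smin u; rewrite nu xu => /(_ isT); rewrite leqNgt us.
congr Some; apply/eqP; rewrite eqn_leq smin ?nt//= leqNgt; apply/negP => st.
by move: xs; rewrite xu ?eqxx// ns.
Qed.

(** For [s <= t], the last element of the [rho]-orbit of [s] that is at most [t],
    computed bit by bit; for [t < s] the orbit has not started and the value
    is [s]. *)
Fixpoint visit (x : binseq) (s t : nat) : nat :=
  if t is t'.+1 then
    if (t <= s)%N then s
    else if symb x t == symb x (t - visit x s t') then visit x s t' else t
  else s.

Lemma visit_start x s t : (t <= s)%N -> visit x s t = s.
Proof. by case: t => //= t ->. Qed.

Lemma visitS x s t : (s <= t)%N -> visit x s t.+1 =
  if symb x t.+1 == symb x (t.+1 - visit x s t) then visit x s t else t.+1.
Proof. by move=> st /=; rewrite ltnNge st. Qed.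

Lemma visit_itv x s t : (s <= t)%N -> (s <= visit x s t <= t)%N.
Proof.
elim: t => [|t IH]; first by rewrite leqn0 => /eqP ->.
rewrite leq_eqVlt => /predU1P[->|]; first by rewrite visit_start ?leqnn.
rewrite ltnS => st; rewrite visitS//; case: ifP => _; move: (IH st); lia.
Qed.

Lemma visit_ext x y s t : (forall i, (i < t)%N -> x i = y i) ->
  visit x s t = visit y s t.
Proof.
elim: t => //= t IH xy; rewrite IH => [|i it]; last by apply: xy; lia.
by rewrite /symb !xy//; lia.
Qed.

Lemma visit_merged x a b t t' : (a <= t)%N -> (b <= t)%N -> (t <= t')%N ->
  visit x a t = visit x b t -> visit x a t' = visit x b t'.
Proof.
move=> ta tb /subnK <- ab; elim: (t' - t)%N => // n IH.
by rewrite addSn !visitS ?IH//; lia.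
Qed.

(** At time [t] the bits after [p = visit x s t] agree with the initial bits;
    the first disagreement occurs at [rho x p], which is when the recursion
    moves on. *)
Lemma orb_visit x s m : orb x s m <-> (s <= m)%N /\ visit x s m = m.
Proof.
split.
  case=> i; elim: i m => [|i IH] m /=; first by case=> <-; rewrite visit_start.
  case E: (iter _ _ _) => [p|]//= /rhoP[pm xm xu].
  have [sp vp] := IH p E.
  have V u : (p <= u < m)%N -> visit x s u = p.
    elim: u => [|u IHu]; first by rewrite leqn0 => /andP[/eqP <-].
    move=> /andP[]; rewrite leq_eqVlt => /predU1P[<-//|]; rewrite ltnS => pu um.
    rewrite visitS; last lia.
    rewrite IHu; last lia.
    by rewrite xu ?eqxx//; lia.
  split; first by lia.
  by case: m pm xm {xu} V => // m pm xm V; rewrite visitS ?V ?(negbTE xm)//; lia.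
move=> [sm <-].
suff [] : orb x s (visit x s m) /\
  forall u, (visit x s m < u <= m)%N -> symb x u = symb x (u - visit x s m) by [].
elim: m sm => [|m IH].
  by rewrite leqn0 => /eqP ->; split; [exists 0|case].
rewrite leq_eqVlt => /predU1P[<-|]; first by rewrite visit_start//; split; [exists 0|lia].
rewrite ltnS => sm; have [[i Hi] V] := IH sm; rewrite visitS//.
have /andP[_ vm] := visit_itv x s m sm.
case: eqP => [E|/eqP E].
  split; first by exists i.
  move=> u /andP[vu]; rewrite leq_eqVlt => /predU1P[->//|um]; apply: V; lia.
split; last lia.
exists i.+1 => /=; rewrite Hi /=; apply/rhoP; split=> //; move=> u Hu; apply: V; lia.
Qed.

Lemma determined_rho n t : determined_by t (fun x => rho x n = Some t).
Proof.
suff H x y : (forall i, (i < t)%N -> x i = y i) -> rho x n = Some t -> rho y n = Some t.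
  by move=> x y xy; apply/propext; split; apply: H => // i /xy.
move=> xy /rhoP[nt xt xu]; apply/rhoP; split=> // [|u Hu].
  by move: xt; rewrite /symb !xy//; lia.
by move: (xu u Hu); rewrite /symb !xy//; lia.
Qed.

Lemma determined_orb s m : determined_by m (fun x => orb x s m).
Proof.
by move=> x y xy; apply/propext; rewrite !orb_visit (visit_ext x y).
Qed.

(** * Measurability of admissibility *)

(** Once the value [t] of [rho x m] is prescribed, all the conditions concern
    the first [m + t] bits. *)
Lemma measurable_fails m : measurable [set x | fails_admissibility x m].
Proof.
rewrite (_ : [set x | _] = \bigcup_t [set x | [/\ ~ internal_address x m,
    forall s, (0 < s < m)%N -> (s %| m)%N -> exists2 u, rho x s = Some u & (u <= m)%N,
    rho x m = Some t &
    forall r, (0 < r <= m)%N -> r = t %[mod m] -> orb x r m]]); last first.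
  apply/seteqP; split=> x; first by case=> ? ? [t ? ?]; exists t.
  by case=> t _ [? ? ? ?]; split=> //; exists t.
apply: bigcup_measurable => t _; apply: (measurable_determined (m + t)) => x y xy.
have om r : orb x r m = orb y r m.
  by apply: (determined_byW (leq_addr t m) (determined_orb r m)).
rewrite /= /internal_address om (determined_byW (leq_addl m t) (determined_rho m t) x y xy).
suff rE s : (exists2 u, rho x s = Some u & (u <= m)%N) =
            (exists2 u, rho y s = Some u & (u <= m)%N).
  apply/propext; split=> -[a b c d]; split=> //.
  - by move=> s s1 s2; rewrite -rE; exact: b.
  - by move=> r r1 r2; rewrite -om; exact: d.
  - by move=> s s1 s2; rewrite rE; exact: b.
  - by move=> r r1 r2; rewrite om; exact: d.
apply/propext; split=> -[u us um]; exists u => //.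
  by rewrite -(determined_byW (leq_trans um (leq_addr t m)) (determined_rho s u) x y xy).
by rewrite (determined_byW (leq_trans um (leq_addr t m)) (determined_rho s u) x y xy).
Qed.

Lemma measurable_admissible : measurable admissible_kneading_sequences.
Proof.
rewrite (_ : admissible_kneading_sequences = [set x : binseq | x 0 = true] `&`
    \bigcap_m ~` (if (0 < m)%N then [set x | fails_admissibility x m] else set0)).
  apply: measurableI; first exact: measurable_coord.
  apply: bigcap_measurableType => m _; apply: measurableC.
  by case: ifP => // _; exact: measurable_fails.
apply/seteqP; split=> x [x1 xa]; split=> // m.
  by move=> _ /=; case: ifP => [m0|_ []]; exact: (xa m m0).
by move=> m0; have := xa m I; rewrite m0.
Qed.

(** * Merging of orbits *)

(** The choice of the bit at time [t + 1] that makes the orbits of [k] and 1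
    merge: if both are compared with the same bit, take the opposite one, so
    that both jump; otherwise take 1. *)
Definition merge_bit (k t : nat) (x : binseq) : bool :=
  symb x (t.+1 - visit x k t) (+) symb x (t.+1 - visit x 1 t) ||
  ~~ symb x (t.+1 - visit x 1 t).

(** While the orbits are apart, they are compared with different bits, since
    otherwise they would merge.  Then exactly one of them jumps, and at the next
    step it is compared with [nu_1 = 1]; the chosen bit is 1, so it stays and
    the other one jumps.  At the third step the two are therefore compared with
    [nu_2 = 1] and [nu_1 = 1], which are equal. *)
Lemma merge_within_3 x k t : (0 < k <= t)%N -> x 0 = true -> x 1 = true ->
  (forall i, (t <= i < t + 3)%N -> x i = merge_bit k i x) ->
  visit x k (t + 3) = visit x 1 (t + 3).
Proof.
move=> /andP[k0 kt] x0 x1 xg.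
have s1 : symb x 1 = true by [].
have s2 : symb x 2 = true by [].
have merge u : (t <= u < t + 3)%N ->
    symb x (u.+1 - visit x k u) = symb x (u.+1 - visit x 1 u) ->
    visit x k u.+1 = visit x 1 u.+1.
  move=> ut E; rewrite !visitS ?E; [|lia..].
  suff -> : symb x u.+1 == symb x (u.+1 - visit x 1 u) = false by [].
  rewrite {1}/symb/= xg// /merge_bit E addbb/=; by case: (symb _ _).
have bit u : (t <= u < t + 3)%N ->
    symb x (u.+1 - visit x k u) != symb x (u.+1 - visit x 1 u) -> symb x u.+1 = true.
  by move=> ut E; rewrite {1}/symb/= xg// /merge_bit; move: E; do 2 case: (symb _ _).
apply/eqP/negPn/negP => /eqP unmerged.
have dis u : (t <= u < t + 3)%N ->
    symb x (u.+1 - visit x k u) != symb x (u.+1 - visit x 1 u).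
  move=> ut; apply/eqP => E; apply: unmerged.
  by apply: (@visit_merged x k 1 u.+1); [lia..|exact: merge].
have D0 := dis t ltac:(lia); have B0 := bit t ltac:(lia) D0.
have D1 := dis t.+1 ltac:(lia); have B1 := bit t.+1 ltac:(lia) D1.
have D2 := dis t.+2 ltac:(lia).
move: D2; rewrite !(visitS _ _ t.+1); [|lia..]; rewrite B1.
move: D1; rewrite !(visitS _ _ t); [|lia..]; rewrite B0.
have [E1 E2 E3] : [/\ (t.+2 - t.+1 = 1), (t.+3 - t.+2 = 1) & (t.+3 - t.+1 = 2)]%N by split; lia.
move: D0; case: (symb x (t.+1 - visit x k t)); case: (symb x (t.+1 - visit x 1 t)) => //= _;
  rewrite E1 s1; case E: (symb x (t.+2 - _)) => //= _.
  by rewrite E2 E3 s1 s2.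
by rewrite E2 E3 s1 s2.
Qed.

(** Only the first five bits are used, through the cylinder below. *)
Definition word11000 : binseq := fun i => (i < 2)%N.

Local Notation C := (cyl 5 word11000).

(** The prefix is part of the event because merging depends on it, and because
    probabilities are to be compared with that of the prefix. *)
Definition unmerged (k t : nat) : set binseq :=
  [set x | C x /\ visit x k t <> visit x 1 t].

Lemma determined_unmerged k t : (5 <= t)%N -> determined_by t (unmerged k t).
Proof.
move=> t5; suff H x y : (forall i, (i < t)%N -> x i = y i) -> unmerged k t x -> unmerged k t y.
  by move=> x y xy; apply/propext; split; apply: H => // i /xy.
move=> xy [xC xv]; split; last by rewrite -!(visit_ext x y).
by move=> i i5; rewrite -xy ?xC//; exact: leq_trans i5 t5.
Qed.

(** If [v (i + 3) <= q * v i] and [v <= c], then the sum [s] satisfies [s <= 3 c + q s]. *)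
Lemma sum_decay3 (R : realFieldType) (v : nat -> R) (c : R) :
  (forall i, 0 <= v i <= c) -> (forall i, v (i + 3)%N <= 7 / 8 * v i) ->
  forall n, \sum_(i < n) v i <= 24 * c.
Proof.
move=> vc v3 n.
have := ler_sum (index_enum 'I_n) (fun i (_ : true) => v3 (i : nat)).
rewrite -mulr_sumr => S3.
have S : \sum_(i < n) v i <= \sum_(i < n + 3) v i.
  by rewrite big_split_ord/= lerDl sumr_ge0// => i _; case/andP: (vc (n + i)%N).
have E : \sum_(i < n + 3) v i = v 0 + (v 1 + (v 2 + \sum_(i < n) v (i + 3)%N)).
  rewrite addn3 !big_ord_recl; do 3 congr (_ + _).
  by apply: eq_bigr => i _; congr v; rewrite /= /bump /=; lia.
have /andP[_ c0] := vc 0; have /andP[_ c1] := vc 1; have /andP[_ c2] := vc 2.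
move: S S3; rewrite E.
set s := \sum_(i < n) v i; set s3 := \sum_(i < n) _; lra.
Qed.

Section merging.
Context {R : realType} (P : probability binseq R).
Context (hP : is_half_product_measure P).
Local Notation pr := (prob P).

Lemma unmerged_decay k t : (0 < k <= t)%N -> (5 <= t)%N ->
  pr (unmerged k (t + 3)) <= 7 / 8 * pr (unmerged k t).
Proof.
move=> kt t5; set S := [set x | forall i, (t <= i < t + 3)%N -> x i = merge_bit k i x].
have dU := determined_unmerged k t t5.
have dg i : (t <= i)%N -> determined_by i (merge_bit k i).
  move=> ti x y xy; rewrite /merge_bit /symb !(visit_ext x y)//.
  have := visit_itv y k i; have := visit_itv y 1 i.
  by move=> v1 vk; rewrite !xy//; lia.
(* The merging strategy is followed with probability 1/8. *)
have := pr_fair_bits P hP t 3 (unmerged k t) (merge_bit k) dU dg; rewrite -/S => ES.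
have mUS := measurable_determined _ _ (determined_bits t 3 _ _ dU dg).
have mU := measurable_determined _ _ dU.
have mU3 : measurable (unmerged k (t + 3)).
  by apply: measurable_determined; apply: determined_unmerged; lia.
have sub : unmerged k (t + 3) `|` (unmerged k t `&` S) `<=` unmerged k t.
  move=> x [[xC xv]|[]//]; split=> // E; apply: xv.
  by apply: (visit_merged _ _ _ t) => //; lia.
have := pr_le P _ _ _ mU sub; rewrite pr_disjointU// ?ES.
  by move=> /(_ (measurableU _ _ mU3 mUS)); rewrite !exprS expr0; lra.
apply/seteqP; split=> // x [[xC xv] [_ xS]]; apply: xv.
by apply: merge_within_3 => //; rewrite xC.
Qed.

Lemma sum_unmerged k n : (5 <= k)%N ->
  \sum_(l < n) pr (unmerged k (k + l)) <= 24 * pr C.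
Proof.
move=> k5; apply: (sum_decay3 _ (fun l => pr (unmerged k (k + l)))) => l.
  rewrite pr_ge0 pr_le//; last by move=> x [].
    by apply: measurable_determined; apply: determined_unmerged; lia.
  exact: measurable_cyl.
by rewrite addnA; apply: unmerged_decay; lia.
Qed.

End merging.

(** * Failures of admissibility after 11000 *)

(** The internal address of a sequence starting with 11000 starts with
    1, 3, 4, 5, and there is no failure for 2 because [rho 1 = 3]; moreover the
    orbits of 1, ..., 5 all contain 5.  So a failure for [m] has [m > 5], and
    the residue [k] of [rho m] modulo [m], whose orbit avoids that of 1 up to
    [m], satisfies [k > 5]. *)
Lemma fails_shape x m : C x -> (0 < m)%N -> fails_admissibility x m ->
  (5 < m)%N /\
  ((forall i, (m <= i < m + m)%N -> x i = x (i - m)%N) \/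
   exists k, [/\ (5 < k <= m)%N, rho x m = Some (m + k)%N &
                 visit x k m <> visit x 1 m]).
Proof.
move=> xC m0 [nm div [t mt tm]].
have vE k t' : (t' <= 5)%N -> visit x k t' = visit word11000 k t'.
  by move=> t5; apply: visit_ext => i it; apply: xC; exact: leq_trans it t5.
have V k : (0 < k <= 5)%N -> visit x k 5 = 5.
  by rewrite vE//; case: k => [|[|[|[|[|[|]]]]]].
have m5 : (5 < m)%N.
  rewrite ltnNge; apply/negP => m5; have [m2|m2] := eqVneq m 2%N.
    have [] := div 1%N => [|//|u /rhoP[u1 + _] u2]; first by rewrite m2.
    by have -> : u = 2%N by [lia]; rewrite /symb !xC.
  apply: nm; apply/orb_visit; split=> //; rewrite vE//.
  by move: m0 m5 m2; case: (m) => [|[|[|[|[|[|]]]]]].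
split=> //; have /rhoP[lmt _ agree] := mt.
have [tle|tgt] := leqP t (m + m); last first.
  left=> i Hi; have := agree i.+1; rewrite /symb /= subSn; last lia.
  by apply; lia.
right; exists (t - m)%N; have E : (m + (t - m) = t)%N by lia.
have tmod : (t - m = t %[mod m])%N by rewrite -[in RHS]E modnDl.
have /orb_visit[_ vm] := tm (t - m)%N ltac:(lia) tmod.
rewrite E; split=> //; last first.
  by rewrite vm => /esym v1; apply: nm; apply/orb_visit.
rewrite leq_subLR tle andbT ltnNge; apply/negP => k5; apply: nm; apply/orb_visit; split=> //.
rewrite -{2}vm; apply: (@visit_merged x 1 (t - m) 5) => //; first lia.
by rewrite !V//; lia.
Qed.

(** The bits with indices [m] to [m + k - 1] that give [rho m = m + k]: they copy
    the initial bits, except for the last one. *)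
Definition jump_bit (m k i : nat) (x : binseq) : bool :=
  (i == (m + k).-1) (+) x (i - m)%N.

Definition repeated m : set binseq :=
  C `&` [set x | forall i, (m <= i < m + m)%N -> x i = x (i - m)%N].

Definition late_jump k m : set binseq :=
  unmerged k m `&`
  [set x | forall i, (m <= i < m + k)%N -> x i = jump_bit m k i x].

(** The second part contains the failures for all [m >= k] with
    [rho m = m + k].  They are grouped by [k] rather than by [m] because the
    sum over [m] of the probabilities that the orbits of [k] and 1 are apart
    at time [m] is bounded independently of [k]. *)
Definition fail_cause k : set binseq :=
  repeated k `|` \bigcup_l late_jump k (k + l).

Lemma fails_cause x m : C x -> (0 < m)%N -> fails_admissibility x m ->
  exists i, fail_cause (5 + i).+1 x.
Proof.
move=> xC m0 /(fails_shape x m xC m0)[m5 [rep|[k [/andP[k5 km] /rhoP[_ mk jump] unm]]]].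
  by exists (m - 6)%N; left; rewrite (_ : (5 + _).+1 = m) ?subnKC//; lia.
exists (k - 6)%N; right; rewrite (_ : (5 + _).+1 = k); last by lia.
exists (m - k)%N => //; rewrite subnKC//; split=> // i Hi; rewrite /jump_bit.
case: eqVneq => [->|ik] /=.
  move: mk; rewrite /symb addKn (_ : ((m + k).-1 - m)%N = k.-1); last by lia.
  by do 2 case: (x _).
have := jump i.+1; rewrite /symb /= subSn; last lia.
by apply; lia.
Qed.

Lemma determined_repeated m : (5 <= m)%N -> determined_by (m + m) (repeated m).
Proof.
move=> m5; apply: (determined_bits m m C (fun i x => x (i - m)%N)).
  by apply: determined_byW m5 (determined_cyl _ _).
by move=> i mi x y; apply; lia.
Qed.

Lemma determined_jump_bit m k i : (0 < m <= i)%N -> determined_by i (jump_bit m k i).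
Proof. by move=> mi x y xy; rewrite /jump_bit xy//; lia. Qed.

Lemma determined_late_jump k m : (5 <= m)%N -> determined_by (m + k) (late_jump k m).
Proof.
move=> m5; apply: determined_bits; first exact: determined_unmerged.
by move=> i mi; apply: determined_jump_bit; lia.
Qed.

Lemma measurable_fail_cause k : (5 <= k)%N ->
  measurable (repeated k) /\ measurable (\bigcup_l late_jump k (k + l)).
Proof.
move=> k5; split; first exact: measurable_determined (determined_repeated _ k5).
apply: bigcup_measurable => l _; apply: measurable_determined.
by apply: determined_late_jump; lia.
Qed.

Lemma sum_half_pow (R : realFieldType) (n k : nat) :
  \sum_(i < n) (2^-1 : R) ^+ (k + i).+1 <= 2^-1 ^+ k.
Proof.
suff -> : \sum_(i < n) (2^-1 : R) ^+ (k + i).+1 = 2^-1 ^+ k - 2^-1 ^+ (k + n).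
  by rewrite gerBl exprn_ge0.
elim: n => [|n IH]; first by rewrite big_ord0 addn0 subrr.
by rewrite big_ord_recr/= IH addnS exprS; lra.
Qed.

Section estimate.
Context {R : realType} (P : probability binseq R).
Context (hP : is_half_product_measure P).
Local Notation pr := (prob P).

Lemma pr_repeated m : (5 <= m)%N -> pr (repeated m) = 2^-1 ^+ m * pr C.
Proof.
move=> m5; apply: (pr_fair_bits P hP m m C (fun i x => x (i - m)%N)).
  by apply: determined_byW m5 (determined_cyl _ _).
by move=> i mi x y; apply; lia.
Qed.

Lemma pr_late_jump k m : (5 <= m)%N ->
  pr (late_jump k m) = 2^-1 ^+ k * pr (unmerged k m).
Proof.
move=> m5; apply: pr_fair_bits => //; first exact: determined_unmerged.
by move=> i mi; apply: determined_jump_bit; lia.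
Qed.

(** The factor [2^-k] is the price of the [k] bits that follow [m]; what remains
    is at most 24 for the expected number of times at which the orbits of [k]
    and 1 are apart, plus 1 for the repetition. *)
Lemma pr_fail_cause k : (5 <= k)%N -> pr (fail_cause k) <= 2^-1 ^+ k * (25 * pr C).
Proof.
move=> k5; have [m1 m2] := measurable_fail_cause k k5.
have H : pr (\bigcup_l late_jump k (k + l)) <= 2^-1 ^+ k * (24 * pr C).
  apply: pr_bigcup_le => [l|n].
    by apply: measurable_determined; apply: determined_late_jump; lia.
  rewrite (eq_bigr (fun l : 'I_n => 2^-1 ^+ k * pr (unmerged k (k + l)))); last first.
    by move=> l _; rewrite pr_late_jump//; lia.
  by rewrite -mulr_sumr ler_wpM2l ?exprn_ge0// sum_unmerged.
have := pr_repeated k k5.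
have : pr (fail_cause k) <= pr (repeated k) + pr (\bigcup_l late_jump k (k + l)).
  rewrite -lee_fin EFinD -!probE//; first exact: measureU2.
  exact: measurableU.
lra.
Qed.

Lemma pr_admissible_gt0 : 0 < pr admissible_kneading_sequences.
Proof.
set E := admissible_kneading_sequences; have mE : measurable E := measurable_admissible.
have mC := measurable_cyl 5 word11000.
have C0 : 0 < pr C by rewrite pr_cyl// exprn_gt0.
have mF i : measurable (fail_cause (5 + i).+1).
  by have [? ?] := measurable_fail_cause (5 + i).+1 ltac:(lia); exact: measurableU.
(* The sum of [2^-k] over [k > 5] is 1/32. *)
have F : pr (\bigcup_i fail_cause (5 + i).+1) <= 2^-1 ^+ 5 * (25 * pr C).
  apply: pr_bigcup_le => // n.
  apply: (@le_trans _ _ (\sum_(i < n) 2^-1 ^+ (5 + i).+1 * (25 * pr C))).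
    by apply: ler_sum => i _; apply: pr_fail_cause; lia.
  by rewrite -mulr_suml ler_wpM2r ?sum_half_pow// mulr_ge0// ltW.
have sub : C `<=` E `|` \bigcup_i fail_cause (5 + i).+1.
  move=> x xC; have [xE|xE] := pselect (E x); [by left|right].
  have : ~ admissible x by move=> xa; apply: xE; split=> //; rewrite /kneading_sequences/= /symb xC.
  move=> /existsNP[m /not_implyP[m0 /contrapT xm]].
  by have [i xi] := fails_cause x m xC m0 xm; exists i.
have mFF : measurable (\bigcup_i fail_cause (5 + i).+1) by exact: bigcup_measurable.
have := pr_le P _ _ mC (measurableU _ _ mE mFF) sub.
have : pr (E `|` \bigcup_i fail_cause (5 + i).+1) <= pr E + pr (\bigcup_i fail_cause (5 + i).+1).
  rewrite -lee_fin EFinD -!probE//; first exact: measureU2.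
  exact: measurableU.
move: F; rewrite !exprS expr0; lra.
Qed.

End estimate.

Theorem theorem1p1 (R : realType) (P : probability binseq R)
    (hP : is_half_product_measure P) :
  measurable admissible_kneading_sequences /\
  (0 < P admissible_kneading_sequences)%E.
Proof.
split; first exact: measurable_admissible.
by rewrite probE ?lte_fin; [exact: pr_admissible_gt0|exact: measurable_admissible].
Qed.
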